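(* For all $n\ge 1$, the descent polynomial $X_n(t):=\sum_{\sigma\in\mathcal{X}_{2n}} t^{\mathrm{des}(\sigma)}$ can be expanded as \[ X_n(t)=\sum_{j=0}^{\lfloor n/2\rfloor} \gamma_{n,j}\, t^j(1+t)^{n-2j}, \] where $\gamma_{n,j}$ is the number of primary even-odd-descent permutations in $\mathcal{X}_{2n}$ with $j$ descents. Moreover, setting $\gamma_{0,0}=1$, the generating function of the $\gamma_{n,j}$ has the continued fraction expansion \[ \sum_{n\ge 0}\Big(\sum_{j=0}^{\lfloor n/2\rfloor} \gamma_{n,j} t^j \Big)x^n=\cfrac{1}{1-\mu_0 x-\cfrac{\lambda_1 x^2}{1-\mu_1 x-\cfrac{\lambda_2 x^2}{1-\mu_2 x-\cdots}}}, \] where $\mu_h=(h+1)^2$ for $h\ge 0$ and $\lambda_h=h^2(h+1)^2 t$ for $h\ge 1$.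
   Context: $\mathfrak{S}_n$ is the set of permutations of $[n]=\{1,\dots,n\}$, written $\sigma=\sigma_1\cdots\sigma_n$. A descent of $\sigma$ is an index $i\in[n-1]$ with $\sigma_i>\sigma_{i+1}$; $\sigma_i$ is then a descent top, $\sigma_{i+1}$ a descent bottom, and $(\sigma_i,\sigma_{i+1})$ a descent pair; $\mathrm{des}(\sigma)$ is the number of descents. A descent pair is even-odd if $\sigma_i$ is even and $\sigma_{i+1}$ is odd. $\mathcal{X}_{m}$ is the set of $\sigma\in\mathfrak{S}_m$ all of whose descent pairs are even-odd. A permutation $\sigma\in\mathcal{X}_{2n}$ with descent tops $\{t_1,\dots,t_k\}$ and descent bottoms $\{b_1,\dots,b_k\}$ ($k\ge0$) is a primary even-odd-descent permutation if for all $i,j$: $t_i>b_j$ implies $t_i-b_j\ge 3$. *)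

(* Defs.v *)
From mathcomp Require Import all_boot all_order all_algebra all_fingroup.
Set Implicit Arguments. Unset Strict Implicit. Unset Printing Implicit Defensive.
Import GRing.Theory.
Local Open Scope ring_scope.

(** Permutations of [m] = {1..m}: we use s : 'S_m on 'I_m = {0..m-1}, the
    value at (1-based) position i+1 being (s i).+1. *)
Definition word (m : nat) (s : 'S_m) : seq nat :=
  [seq (val (s i)).+1 | i <- enum 'I_m].

Definition descents (m : nat) (s : 'S_m) : seq nat :=
  let w := word s in
  [seq i <- iota 0 m.-1 | nth 0%N w i > nth 0%N w i.+1]%N.

Definition des (m : nat) (s : 'S_m) : nat := size (descents s).

Definition descent_pairs (m : nat) (s : 'S_m) : seq (nat * nat) :=
  let w := word s in [seq (nth 0%N w i, nth 0%N w i.+1) | i <- descents s].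

Definition even_odd (p : nat * nat) : bool := ~~ odd p.1 && odd p.2.

Definition inX (m : nat) (s : 'S_m) : bool := all even_odd (descent_pairs s).

Definition primary (m : nat) (s : 'S_m) : bool :=
  inX s &&
  all (fun p => all (fun q => (q.2 < p.1)%N ==> (3 <= p.1 - q.2)%N)
                    (descent_pairs s)) (descent_pairs s).

Definition Xpoly (n : nat) : {poly int} :=
  \sum_(s : 'S_(n.*2) | inX s) 'X^(des s).

Definition gamma (n j : nat) : nat :=
  #|[set s : 'S_(n.*2) | primary s && (des s == j)]|.

Definition Gpoly (n : nat) : {poly int} :=
  if n == 0%N then 1 else \sum_(j < n./2.+1) (gamma n j)%:R *: 'X^j.

Definition series := nat -> {poly int}.

(** inverse of a series with constant coefficient 1 *)
Fixpoint inv_seq (f : series) (n : nat) : seq {poly int} :=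
  match n with
  | 0 => [:: 1]
  | n'.+1 => let s := inv_seq f n' in
      rcons s (- \sum_(k < n'.+1) f k.+1 * nth 0 s (n'.+1 - k.+1))
  end.
Definition sinv (f : series) : series := fun n => nth 0 (inv_seq f n) n.

Definition mu (h : nat) : {poly int} := ((h.+1 ^ 2)%N)%:R.
Definition lambda (h : nat) : {poly int} := ((h ^ 2 * h.+1 ^ 2)%N)%:R *: 'X.

Definition denom (h : nat) (T : series) : series := fun n =>
  match n with
  | 0 => 1
  | 1 => - mu h
  | n'.+2 => - (lambda h.+1 * T n')
  end.

Fixpoint cf (k : nat) : nat -> series :=
  fun h => match k with
  | 0 => sinv (denom h (fun _ => 0))
  | k'.+1 => sinv (denom h (cf k' h.+1))
  end.

(* Main.v *)
Require Import Defs.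
From mathcomp Require Import all_boot all_order all_algebra all_fingroup.
From mathcomp Require Import zify ring.
Import GRing.Theory.
Set Implicit Arguments. Unset Strict Implicit. Unset Printing Implicit Defensive.

(** Build a permutation by inserting the values 1, 2, ... in increasing order.
    The letters present at some stage form blocks separated by gaps ("bars") that
    are still to be filled with larger letters; a new letter goes into a gap and
    either splits it (valley), stays at one end of it, or closes it (peak).  In
    [X_2n] odd values are valleys or double ascents and even values are peaks or
    double ascents.  Processing the values [2i-1, 2i] together with [b] gaps open,
    there are [b(b+1)] ways to gain a gap, [b(b-1)] ways (weight [t]) to lose one,
    and [b^2] ways to keep [b] by two ascents or, with weight [t], by a valley and
    a peak.  Hence [X_n] counts Motzkin paths with level weights [(1+t) b^2], while
    the primary permutations are exactly those without a valley at [2i-1] followed by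
    a peak at [2i], and count the same paths with level weights [b^2].  Comparing the
    two path sums gives the gamma expansion, and the second one is the J-fraction. *)

(** * Words with bars *)

(* Letters of a word are positive; the letter 0 is a bar, larger than every letter. *)
Definition big (v x : nat) : bool := (x == 0) || (v < x).

(* Whether the left, resp. right, neighbour of [v] in [u] is larger; the left end
   of the word counts as small, its right end as a bar. *)
Definition typ (u : seq nat) (v : nat) : bool * bool :=
  let i := index v u in
  ((0 < i) && big v (nth 0 u i.-1), big v (nth 0 u i.+1)).

(* The type of the largest letter [m] comes first. *)
Fixpoint types (m : nat) (u : seq nat) : seq (bool * bool) :=
  if m is m'.+1 then typ u m :: types m' u else [::].

Fixpoint splits (u : seq nat) : seq (seq nat * seq nat) :=
  if u is x :: s then
    (if x == 0 then [:: ([::], s)] else [::])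
      ++ [seq (x :: p.1, p.2) | p <- splits s]
  else [::].

(** The components of [a] tell on which sides of [m] a gap for larger letters stays open. *)
Definition fill (a : bool * bool) (m : nat) : seq nat :=
  nseq a.1 0 ++ m :: nseq a.2 0.

(* The final bar stands for the right end of the permutation and is never closed. *)
Definition slots (a : bool * bool) (u : seq nat) : seq (seq nat * seq nat) :=
  [seq p <- splits u | a.2 || (p.2 != [::])].

Fixpoint states (tau : seq (bool * bool)) : seq (seq nat) :=
  if tau is a :: tau' then
    [seq p.1 ++ fill a (size tau').+1 ++ p.2
      | u <- states tau', p <- slots a u]
  else [:: [:: 0]].

Fixpoint bars (tau : seq (bool * bool)) : nat :=
  if tau is a :: tau' then (bars tau').-1 + a.1 + a.2 else 1.

Definition apart (x y : nat) : bool := (x != 0) || (y != 0).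

(** Two adjacent bars would stand for one and the same gap. The dummy letter 1 in [path] lets a word
    start with a bar; in [last] it rules out the empty word. *)
Definition wf (m : nat) (u : seq nat) : bool :=
  [&& perm_eq [seq x <- u | x != 0] (iota 1 m), path apart 1 u & last 1 u == 0].

(** The type of [v] only records which neighbours are larger, and every entry of [y] is; hence [y]
    is absent from the right-hand side, and a bar may be exchanged for its filling. *)
Lemma typ_catE (l y r : seq nat) (v : nat) : v != 0 -> y != [::] -> all (big v) y -> v \in l ++ r ->
  typ (l ++ y ++ r) v =
  if v \in l then
    ((0 < index v l) && big v (nth 0 l (index v l).-1),
     ((index v l).+1 == size l) || big v (nth 0 l (index v l).+1))
  else ((index v r == 0) || big v (nth 0 r (index v r).-1),
        big v (nth 0 r (index v r).+1)).
Proof.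
move=> v0 y0 ay; rewrite mem_cat /typ.
have ic (p q : seq nat) :
  index v (p ++ q) = if v \in p then index v p else size p + index v q.
  exact: index_cat.
rewrite !ic.
have vy : v \notin y.
  by apply/negP => /(allP ay); rewrite /big (negPf v0) ltnn.
have sy : 0 < size y by case: (y) y0.
rewrite (negPf vy); case: ifP => vl /=.
  have {}vl : index v l < size l by rewrite index_mem.
  move=> _; congr (_, _).
    by case: (index v l) vl => //= i il; rewrite nth_cat (ltnW il).
  rewrite nth_cat; have [il|il] := ltnP (index v l).+1 (size l).
    by rewrite (ltn_eqF il).
  have -> : (index v l).+1 = size l by lia.
  rewrite eqxx subnn nth_cat sy /=; apply: (allP ay); exact: mem_nth.
move=> vr; move: (index v r) => j.
congr (_, _).
  rewrite nth_cat; case: (j =P 0) => [->|j0].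
    rewrite addn0 addn_gt0 sy orbT ifF; last by lia.
    rewrite nth_cat ifT; last by lia.
    have sl : (size l + size y).-1 - size l < size y by lia.
    exact/(allP ay)/mem_nth.
  rewrite addn_gt0 (addn_gt0 (size y)) sy orbT ifF; last by lia.
  rewrite nth_cat ifF; last by lia.
  by congr (big _ (nth _ _ _)); lia.
rewrite nth_cat ifF; last by lia.
rewrite nth_cat ifF; last by lia.
by congr (big _ (nth _ _ _)); lia.
Qed.

Lemma typ_subst (l y r : seq nat) (v : nat) :
  v != 0 -> y != [::] -> all (big v) y -> v \in l ++ r ->
  typ (l ++ y ++ r) v = typ (l ++ 0 :: r) v.
Proof. by move=> *; rewrite (@typ_catE l [:: 0]) // typ_catE. Qed.

Lemma eq_types m u u' : (forall v, 0 < v <= m -> typ u v = typ u' v) ->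
  types m u = types m u'.
Proof.
elim: m => //= m IH H; rewrite H ?leqnn ?IH // => v /andP[v0 vm].
by apply: H; rewrite v0 leqW.
Qed.

Lemma size_types m u : size (types m u) = m.
Proof. by elim: m => //= m ->. Qed.

Lemma fill_big a m v : v < m -> all (big v) (fill a m).
Proof. by move=> vm; case: a => [[] []]; rewrite /fill /= /big /= vm ?orbT. Qed.

Lemma fill_neq0 a m : fill a m != [::].
Proof. by case: a => [[] b]. Qed.

Lemma cat_fill a m l r :
  l ++ fill a m ++ r = (l ++ nseq a.1 0) ++ m :: (nseq a.2 0 ++ r).
Proof. by rewrite /fill -!catA. Qed.

Lemma splits_cat u p : p \in splits u -> u = p.1 ++ 0 :: p.2.
Proof.
elim: u p => //= x s IH p; rewrite mem_cat => /orP[|].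
  by case: eqP => // ->; rewrite inE => /eqP ->.
by case/mapP => q /IH -> ->.
Qed.

Lemma mem_splits l r : (l, r) \in splits (l ++ 0 :: r).
Proof.
elim: l => [|x l IH] /=; first by rewrite inE eqxx.
by rewrite mem_cat; apply/orP; right; apply/mapP; exists (l, r).
Qed.

Lemma splits_uniq u : uniq (splits u).
Proof.
elim: u => //= x s IH; rewrite cat_uniq map_inj_uniq ?IH; last first.
  by move=> [a b] [c d] /= [-> ->].
rewrite andbT; case: ifP => _; last by rewrite has_pred0.
by apply/hasP => -[_ /mapP[q _ ->]]; rewrite inE.
Qed.

Lemma size_splits u : size (splits u) = count_mem 0 u.
Proof.
by elim: u => //= x s IH; rewrite size_cat size_map IH; case: ifP.
Qed.

Lemma size_slots a u : last 1 u = 0 -> size (slots a u) = count_mem 0 u - ~~ a.2.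
Proof.
rewrite /slots; case: a.2 => /=.
  by rewrite filter_predT size_splits subn0.
elim: u => // x [|y s] IH lu; first by move: lu => /= ->.
set s' := y :: s in IH lu *.
have ls : last 1 s' = 0 by [].
have cs : 0 < count_mem 0 s' by rewrite -has_count has_pred1 -ls /s' /= mem_last.
rewrite [splits _]/= filter_cat size_cat filter_map size_map.
rewrite (@eq_filter _ _ (fun p => p.2 != [::])) //.
move: (IH ls) => ->; rewrite -[count_mem 0 (x :: s')]/((x == 0) + count_mem 0 s').
by case: ifP => _; rewrite /= ?add0n ?subn1 ?add1n /= ?prednK.
Qed.

Lemma states_count tau u : u \in states tau -> count_mem 0 u = bars tau.
Proof.
elim: tau u => [|a tau IH] u /=; first by rewrite inE => /eqP ->.
case/allpairsPdep => u' [p [/IH hu]].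
rewrite mem_filter => /andP[_ /splits_cat hp] ->.
rewrite -hu hp !count_cat /= !count_nseq /=; lia.
Qed.

Lemma wf_memE m u v : wf m u -> v != 0 -> (v \in u) = (v <= m).
Proof.
case/and3P => /perm_mem /(_ v) + _ _ v0.
by rewrite mem_filter v0 mem_iota add1n ltnS lt0n v0.
Qed.

Lemma cat_pivot_inj (x : nat) (l r l' r' : seq nat) :
  x \notin l -> x \notin l' -> l ++ x :: r = l' ++ x :: r' -> l = l' /\ r = r'.
Proof.
move=> xl xl' E.
have := congr1 (index x) E; rewrite !index_cat (negPf xl) (negPf xl') /= eqxx !addn0.
by move=> sE; move/eqP: E; rewrite eqseq_cat // => /andP[/eqP -> /eqP[->]].
Qed.

(** The letter [m] can hide an old bar that touched the filled one, so the absence of such a bar is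
    stated separately on the left. *)
Lemma path_apart_fill a (m : nat) l r : m != 0 ->
  path apart 1 (l ++ fill a m ++ r) && (last 1 l != 0) && (head 1 r != 0) =
  path apart 1 (l ++ 0 :: r).
Proof.
move=> m0; rewrite !cat_path /= /apart /= (negPf m0) /= orbF.
rewrite /fill; case: a => [[] []]; case: r => [|y r] /=; rewrite ?m0 ?andbT ?andbF ?orbF ?orbT //=;
  case: (last 1 l == 0) => //=; case: (path _ 1 l) => //=; rewrite ?andbT ?andbF //; by case: (y == 0); rewrite ?andbT ?andbF.
Qed.

Lemma perm_fill a m l r :
  perm_eq [seq x <- l ++ fill a m.+1 ++ r | x != 0] (iota 1 m.+1) =
  perm_eq [seq x <- l ++ 0 :: r | x != 0] (iota 1 m).
Proof.
have -> : iota 1 m.+1 = iota 1 m ++ [:: m.+1] by rewrite -[in LHS](addn1 m) iotaD add1n.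
have : [seq x <- fill a m.+1 | x != 0] = [:: m.+1] by case: a => [[] []].
move: (fill _ _) => f f_m; rewrite !filter_cat f_m /=.
by rewrite perm_sym perm_catC perm_sym (perm_catCA _ [:: m.+1]) perm_cat2l.
Qed.

Lemma last_fill a m l r :
  (last 1 (l ++ fill a m.+1 ++ r) == 0) =
  (last 1 (l ++ 0 :: r) == 0) && (a.2 || (r != [::])).
Proof. by rewrite !last_cat; case: r => [|x r]; case: a => [[] []] /=; rewrite ?andbT. Qed.

Lemma wf_fill a m l r :
  [&& wf m.+1 (l ++ fill a m.+1 ++ r), last 1 l != 0 & head 1 r != 0] =
  wf m (l ++ 0 :: r) && (a.2 || (r != [::])).
Proof.
rewrite /wf perm_fill last_fill -(@path_apart_fill a m.+1) //.
by apply/idP/idP => [/and3P[/and4P[-> -> -> ->] -> ->]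
  | /andP[/and3P[-> /andP[/andP[-> ->] ->] ->] ->]].
Qed.

Lemma typ_fill a m l r : wf m (l ++ 0 :: r) -> last 1 l != 0 -> head 1 r != 0 ->
  a.2 || (r != [::]) -> typ (l ++ fill a m.+1 ++ r) m.+1 = a.
Proof.
move=> w l0 r0 ar.
(* All letters already present are at most [m], so next to [m.+1] only a bar counts as larger. *)
have nb x : x != 0 -> x \in l ++ 0 :: r -> big m.+1 x = false.
  by move=> x0; rewrite (wf_memE w) // /big (negPf x0) /= => xm; rewrite ltnNge leqW.
have ml : m.+1 \notin l.
  apply/negP => h; have := wf_memE w (isT : m.+1 != 0).
  by rewrite mem_cat h ltnn.
have sz (p : seq nat) : m.+1 \notin p -> forall q, index m.+1 (p ++ m.+1 :: q) = size p.
  by move=> mp q; rewrite index_cat (negPf mp) /= eqxx addn0.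
rewrite cat_fill /typ sz; last by rewrite mem_cat mem_nseq negb_or ml andbF.
rewrite (nth_cat _ _ _ _.+1) ifF ?ltnNge ?leqnSn // subSn // subnn /=.
case: a ar => [a1 a2] /= ar; congr (_, _).
  case: a1; rewrite ?cats0 nth_cat /=.
    by rewrite size_cat addn1 /= ltnSn nth_cat ltnn subnn.
  case/lastP: l l0 nb {w ml} => //= l x; rewrite last_rcons size_rcons /= => x0 nb.
  rewrite ltnSn nth_rcons ltnn eqxx nb //.
  by rewrite mem_cat mem_rcons inE eqxx.
case: a2 ar => //=; case: r r0 nb {w} => //= x r x0 nb _.
by rewrite nb // mem_cat !inE eqxx !orbT.
Qed.

Lemma types_fill a m l r : wf m (l ++ 0 :: r) ->
  types m (l ++ fill a m.+1 ++ r) = types m (l ++ 0 :: r).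
Proof.
move=> w; apply: eq_types => v /andP[v0 vm].
rewrite typ_subst ?fill_neq0 ?fill_big -?lt0n //.
have := wf_memE w (_ : v != 0); rewrite -lt0n v0 vm => /(_ isT).
by rewrite !mem_cat inE (gtn_eqF v0).
Qed.

(** Bars are never adjacent, so the largest letter has at most one bar on each side; these bars
    determine [a]. *)
Lemma wf_unfill m u : wf m.+1 u ->
  exists a l r, [/\ u = l ++ fill a m.+1 ++ r, last 1 l != 0 & head 1 r != 0].
Proof.
move=> w; have mu : m.+1 \in u by rewrite (wf_memE w).
case/splitPr: mu w => l0 r0 /and3P[_ + lu].
rewrite cat_path /= => /and3P[pl _ pr].
have [l [a1 [-> l_end]]] : exists l (a1 : bool), l0 = l ++ nseq a1 0 /\ last 1 l != 0.
  case/lastP: l0 pl {lu} => [|l x]; first by exists [::], false.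
  rewrite rcons_path /apart => /andP[_].
  have [-> /=|x0 _] := eqVneq x 0.
    by rewrite orbF; exists l, true; rewrite cats1.
  by exists (rcons l x), false; rewrite cats0 last_rcons.
have [r [a2 [-> r_head]]] : exists r (a2 : bool), r0 = nseq a2 0 ++ r /\ head 1 r != 0.
  case: r0 pr {lu} => [|x r] /=; first by exists [::], false.
  have [->|x0 _] := eqVneq x 0; last by exists (x :: r), false.
  by move=> pr; exists r, true; split=> //; case: (r) pr => //= y r' /andP[].
by exists (a1, a2), l, r; rewrite /fill -!catA.
Qed.

(** Removing the largest letter inverts an insertion, and by [types_fill] an insertion leaves the
    types of the smaller letters alone. *)
Lemma mem_states tau u :
  (u \in states tau) = wf (size tau) u && (types (size tau) u == tau).
Proof.
elim: tau u => [|a tau IH] u.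
  rewrite inE /= andbT; apply/eqP/idP => [->//|].
  case/and3P => /perm_nilP u0 pu lu.
  have {}u0 : all (pred1 0) u.
    apply/allP => x xu; apply: contraT => x0.
    by have := mem_filter (predC1 0) x u; rewrite /= x0 xu u0.
  case: u u0 pu lu => [|x [|y s]] //=; first by move=> _ _ /eqP ->.
  by case/and3P => /eqP -> /eqP ->.
apply/allpairsPdep/andP => [[u' [[l r] []]]|[w /eqP[ta tt]]].
  rewrite IH mem_filter => /andP[w /eqP <-] /andP[ar /splits_cat /= def_u] ->.
  move: w; rewrite {}def_u => w.
  move: (wf_fill a (size tau) l r); rewrite w ar => /and3P[wf' l0 r0].
  by rewrite size_types /= wf' typ_fill // types_fill.
have [b [l [r [def_u l0 r0]]]] := wf_unfill w; move: ta tt w; rewrite {u}def_u => ta tt w.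
move: (wf_fill b (size tau) l r); rewrite w l0 r0 /= => /esym/andP[w' br].
have ab : b = a by rewrite -ta typ_fill.
exists (l ++ 0 :: r), (l, r); rewrite IH w' -(types_fill b w') tt eqxx ab; split=> //.
by rewrite mem_filter mem_splits -ab br.
Qed.

(** The largest letter marks the last insertion and [a] fixes the bars added around it, so the
    earlier word and the filled bar can be recovered. *)
Lemma states_uniq tau : uniq (states tau).
Proof.
elim: tau => //= a tau IH; apply: allpairs_uniq_dep => //.
  by move=> u _; rewrite filter_uniq ?splits_uniq.
have mem (v : {_ : seq nat & (seq nat * seq nat)%type}) :
    v \in [seq existT (fun=> (seq nat * seq nat)%type) x y | x <- states tau, y <- slots a x] ->
    [/\ tag v = (tagged v).1 ++ 0 :: (tagged v).2 & (size tau).+1 \notin tag v].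
  case/allpairsPdep => u [p [us ps ->]] /=; split.
    by move: ps; rewrite mem_filter => /andP[_ /splits_cat].
  by move: us; rewrite mem_states => /andP[w _]; rewrite (wf_memE w) ?ltnn.
move=> [u [l r]] [u' [l' r']] /mem[/= -> +] /mem[/= -> +].
rewrite !mem_cat !negb_or => /andP[ml _] /andP[ml' _].
rewrite /= !cat_fill => E.
have [||E1 E2] := cat_pivot_inj _ _ E; rewrite ?mem_cat ?negb_or ?ml ?ml' ?mem_nseq ?andbF //.
have sl : size l = size l'.
  by move/(congr1 size): E1; rewrite !size_cat => /addIn.
move/eqP: E1; rewrite eqseq_cat // => /andP[/eqP -> _].
by move/eqP: E2; rewrite eqseq_cat // => /andP[_ /eqP ->].
Qed.

(** All words in [states tau] have equally many fillable bars, so the count is a product. *)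
Lemma size_states a tau :
  size (states (a :: tau)) = size (states tau) * (bars tau - ~~ a.2).
Proof.
rewrite /= size_allpairs_dep -sum1_size big_distrl /= sumnE big_map.
rewrite big_seq [RHS]big_seq; apply: eq_bigr => u us.
rewrite mul1n size_slots ?(states_count us) //.
by move: us; rewrite mem_states => /andP[/and3P[_ _ /eqP]].
Qed.

(** * Words of permutations *)

Definition closed_word (m : nat) (s : 'S_m) : seq nat := rcons (word s) 0.

Lemma size_word m (s : 'S_m) : size (word s) = m.
Proof. by rewrite size_map -cardE card_ord. Qed.

Lemma word_uniq m (s : 'S_m) : uniq (word s).
Proof.
by rewrite map_inj_uniq ?enum_uniq // => i j [] /val_inj /perm_inj.
Qed.

Lemma mem_word m (s : 'S_m) v : (v \in word s) = (0 < v <= m).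
Proof.
apply/mapP/idP => [[i _ ->]|/andP[v0 vm]]; first by rewrite ltn_ord.
have lt_v : v.-1 < m by rewrite prednK.
exists ((s^-1)%g (Ordinal lt_v)); first by rewrite mem_enum.
by rewrite permKV /= prednK.
Qed.

Lemma nth_word m (s : 'S_m) (i : 'I_m) : nth 0 (word s) i = (s i).+1.
Proof.
have im : i < size (enum 'I_m) by rewrite -cardE card_ord.
by rewrite (nth_map i) // nth_ord_enum.
Qed.

Lemma word_inj m : injective (@word m).
Proof.
move=> s s' E; apply/permP => i; apply/val_inj.
have: nth 0 (word s) i = nth 0 (word s') i by rewrite E.
by rewrite !nth_word => -[].
Qed.

Lemma wordP m w : perm_eq w (iota 1 m) -> exists s : 'S_m, word s = w.
Proof.
move=> hp; have sw : size w = m by rewrite (perm_size hp) size_iota.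
have uw : uniq w by rewrite (perm_uniq hp) iota_uniq.
have nw (i : 'I_m) : 0 < nth 0 w i <= m.
  have := perm_mem hp (nth 0 w i).
  by rewrite mem_nth ?sw // mem_iota add1n ltnS => /esym.
(* The default [i] is never taken: by [nw] all entries lie between 1 and [m]. *)
pose f (i : 'I_m) := insubd i (nth 0 w i).-1.
have fE i : (val (f i)).+1 = nth 0 w i.
  by have /andP[n0 nm] := nw i; rewrite /f val_insubd prednK // nm prednK.
have f_inj : injective f.
  move=> i j /(congr1 (fun x => (val x).+1)); rewrite !fE => /eqP.
  by rewrite nth_uniq ?sw // => /eqP /val_inj.
exists (perm f_inj); apply: (@eq_from_nth _ 0); rewrite size_word ?sw // => i im.
by rewrite (nth_word _ (Ordinal im)) permE fE.
Qed.

Lemma perm_word m (s : 'S_m) : perm_eq (word s) (iota 1 m).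
Proof.
apply: uniq_perm; rewrite ?word_uniq ?iota_uniq // => v.
by rewrite mem_word mem_iota add1n ltnS.
Qed.

Lemma notin0_word m (s : 'S_m) : 0 \notin word s.
Proof. by rewrite mem_word. Qed.

Lemma filter_word m (s : 'S_m) : [seq x <- word s | x != 0] = word s.
Proof. by apply/all_filterP/allP => x; rewrite mem_word => /andP[]; case: x. Qed.

Lemma wf_closed_word m (s : 'S_m) : wf m (closed_word s).
Proof.
apply/and3P; split; last by rewrite last_rcons.
  by rewrite filter_rcons /= filter_word perm_word.
rewrite rcons_path /apart /=.
have nz x : x \in word s -> x != 0 by rewrite mem_word => /andP[]; case: x.
have last0 : last 1 (word s) != 0.
  by case: (word s) nz => //= x w nz; rewrite nz // mem_last.
rewrite last0 /= andbT; elim: (word s) (1) nz => //= y w IH x nz.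
rewrite (nz y) ?mem_head // orbT /=.
by apply: IH => z zw; rewrite nz ?inE ?zw ?orbT.
Qed.

(** A single bar has to be the final one, and deleting it leaves an arrangement of the letters 1 to
    [m]. *)
Lemma states_closed_word m (tau : seq (bool * bool)) (u : seq nat) :
  size tau = m -> bars tau = 1 -> u \in states tau ->
  exists2 s : 'S_m, u = closed_word s & types m (closed_word s) = tau.
Proof.
move=> sz b1 us; have := states_count us; rewrite b1.
move: us; rewrite mem_states sz => /andP[/and3P[hp _ lu] /eqP tt].
case/lastP: u lu hp tt => // w x; rewrite last_rcons => /eqP -> hp tt.
rewrite -cats1 count_cat /= addn1 => -[c0].
have w0 : [seq x <- w | x != 0] = w.
  apply/all_filterP; rewrite all_predC has_pred1.
  by rewrite -has_pred1 has_count c0.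
move: hp; rewrite filter_rcons /= w0 => /wordP[s def_w].
by exists s; rewrite /closed_word def_w ?cats1.
Qed.

Lemma card_types m tau : size tau = m ->
  #|[set s : 'S_m | types m (closed_word s) == tau]| =
  if bars tau == 1 then size (states tau) else 0.
Proof.
move=> sz; case: eqP => [b1|b1]; last first.
  apply/eqP; rewrite cards_eq0; apply/eqP/setP => s; rewrite !inE.
  apply/negbTE/eqP => tt; apply: b1.
  have /states_count <- : closed_word s \in states tau.
    by rewrite mem_states sz wf_closed_word tt eqxx.
  rewrite /closed_word -cats1 count_cat /= addn1; congr _.+1.
  by apply/eqP; rewrite -leqn0 leqNgt -has_count has_pred1 notin0_word.
rewrite cardE -(size_map (@closed_word m)); apply/perm_size/uniq_perm.
- rewrite map_inj_uniq ?enum_uniq // => s s' /eqP.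
  by rewrite eqseq_rcons andbT => /eqP/word_inj.
- exact: states_uniq.
move=> u; apply/mapP/idP => [[s]|us].
  by rewrite mem_enum inE => tt ->; rewrite mem_states sz wf_closed_word.
have [s def_u tt] := states_closed_word sz b1 us.
by exists s; rewrite // mem_enum inE tt.
Qed.

(** * Types of letters and descents *)

Lemma nth_closed_word m (s : 'S_m) i : nth 0 (closed_word s) i = nth 0 (word s) i.
Proof. by rewrite nth_rcons; case: ltnP => // h; rewrite if_same nth_default. Qed.

Lemma index_closed_word m (s : 'S_m) i : i < m ->
  index (nth 0 (word s) i) (closed_word s) = i.
Proof.
move=> im; rewrite /closed_word -cats1 index_cat mem_nth ?size_word //.
by rewrite index_uniq ?size_word ?word_uniq.
Qed.

Lemma typ_closed_word m (s : 'S_m) i : i < m ->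
  typ (closed_word s) (nth 0 (word s) i) =
  ((0 < i) && (nth 0 (word s) i < nth 0 (word s) i.-1),
   (m <= i.+1) || (nth 0 (word s) i < nth 0 (word s) i.+1)).
Proof.
move=> im; rewrite /typ index_closed_word // !nth_closed_word /big.
have nz j : (nth 0 (word s) j == 0) = (m <= j).
  apply/eqP/idP => [h|jm]; last by rewrite nth_default ?size_word.
  rewrite leqNgt; apply/negP => jm; have := mem_nth 0 (s := word s) (n := j).
  by rewrite size_word h mem_word => /(_ jm).
by rewrite !nz; case: i im => //= i im; rewrite leqNgt (ltnW im).
Qed.

Lemma word_nthP m (s : 'S_m) v : 0 < v <= m -> exists2 i, i < m & v = nth 0 (word s) i.
Proof.
by rewrite -(mem_word s) => /(nthP 0)[i]; rewrite size_word => im <-; exists i.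
Qed.

Lemma mem_descents m (s : 'S_m) i :
  (i \in descents s) = (i.+1 < m) && (nth 0 (word s) i.+1 < nth 0 (word s) i).
Proof.
by rewrite mem_filter mem_iota add0n andbC /=; case: m s => //= m s; rewrite ltnS.
Qed.

Lemma nth_word_neq m (s : 'S_m) i j : i < m -> j < m -> i != j ->
  nth 0 (word s) i != nth 0 (word s) j.
Proof. by move=> im jm; rewrite nth_uniq ?size_word ?word_uniq. Qed.

Lemma mem_tops m (s : 'S_m) v :
  (v \in [seq p.1 | p <- descent_pairs s]) = (0 < v <= m) && ~~ (typ (closed_word s) v).2.
Proof.
rewrite -map_comp; apply/mapP/andP => [[i]|[vm]].
  rewrite mem_descents => /andP[im lt_v ->].
  rewrite -[v in typ _ v]/(nth 0 (word s) i) typ_closed_word ?(ltnW im) //=.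
  by rewrite -(mem_word s) mem_nth ?size_word ?(ltnW im) // leqNgt im /= -leqNgt ltnW.
have [i im ->] := word_nthP s vm; rewrite typ_closed_word //= negb_or -ltnNge -leqNgt.
case/andP => im' le_v; exists i => //; rewrite mem_descents im' /=.
by rewrite ltn_neqAle le_v nth_word_neq // eq_sym ltn_eqF.
Qed.

Lemma mem_bottoms m (s : 'S_m) v :
  (v \in [seq p.2 | p <- descent_pairs s]) = (0 < v <= m) && (typ (closed_word s) v).1.
Proof.
rewrite -map_comp; apply/mapP/andP => [[i]|[vm]].
  rewrite mem_descents => /andP[im lt_v ->].
  rewrite -[v in typ _ v]/(nth 0 (word s) i.+1) typ_closed_word //=.
  by rewrite -(mem_word s) mem_nth ?size_word.
have [[|i] im ->] := word_nthP s vm; rewrite typ_closed_word //= => lt_v.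
by exists i => //; rewrite mem_descents im.
Qed.

Lemma des_types m (s : 'S_m) :
  des s = count (fun a => ~~ a.2) (types m (closed_word s)).
Proof.
have -> : forall k u, count (fun a => ~~ a.2) (types k u) =
    count (fun v => ~~ (typ u v).2) (iota 1 k).
  move=> k u; elim: k => // k IH.
  by rewrite -[in RHS](addn1 k) iotaD count_cat add1n addnC /= IH addn0.
rewrite -(seq.permP (perm_word s)) -(mkseq_nth 0 (word s)) size_word.
rewrite /mkseq count_map /des size_filter.
case: m s => [|m] s //.
(* The last position is split off: it is followed by the closing bar and starts no descent. *)
have -> : iota 0 m.+1 = iota 0 m ++ [:: m] by rewrite -[in LHS](addn1 m) iotaD.
rewrite count_cat -[LHS]addn0; congr (_ + _); last first.
  rewrite -[RHS]/(~~ (typ (closed_word s) (nth 0 (word s) m)).2 + 0)%N.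
  by rewrite typ_closed_word //= leqnn.
apply: eq_in_count => i; rewrite mem_iota add0n /= => im.
rewrite -[RHS]/(~~ (typ (closed_word s) (nth 0 (word s) i)).2).
rewrite typ_closed_word /=; last exact: ltnW.
rewrite ltnS [m <= i]leqNgt im /= ltn_neqAle -leqNgt nth_word_neq // ?ltnS // ?gtn_eqF //.
exact: ltnW.
Qed.

(** Being even-odd separates into a condition on tops and one on bottoms, so it can be tested letter
    by letter. *)
Lemma inX_typ m (s : 'S_m) :
  inX s = all (fun v => ((typ (closed_word s) v).2 || ~~ odd v) &&
                        ((typ (closed_word s) v).1 ==> odd v)) (iota 1 m).
Proof.
have -> : inX s = all (predC odd) [seq p.1 | p <- descent_pairs s]
               && all odd [seq p.2 | p <- descent_pairs s].
  rewrite /inX; elim: (descent_pairs s) => //= p l ->.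
  by rewrite /even_odd andbACA.
apply/andP/allP => [[/allP top /allP bot] v|H].
  rewrite mem_iota add1n ltnS => vm; apply/andP; split.
    by rewrite -implyNb; apply/implyP => tv; apply: top; rewrite mem_tops vm.
  by apply/implyP => bv; apply: bot; rewrite mem_bottoms vm.
split; apply/allP => v; rewrite ?mem_tops ?mem_bottoms => /andP[vm].
  by have := H v; rewrite mem_iota add1n ltnS vm => /(_ isT)/andP[/orP[->|]].
by have := H v; rewrite mem_iota add1n ltnS vm => /(_ isT)/andP[_ /implyP].
Qed.

(** Tops are even and bottoms odd, so a positive difference is odd and is below 3 only when it
    equals 1. *)
Lemma primary_typ m (s : 'S_m) :
  primary s = inX s && all (fun v => (typ (closed_word s) v.+1).2 || ~~ (typ (closed_word s) v).1)
                           (iota 1 m.-1).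
Proof.
rewrite /primary; apply: andb_id2l => xs.
have gap t b : t \in [seq p.1 | p <- descent_pairs s] ->
    b \in [seq p.2 | p <- descent_pairs s] -> ~~ odd t && odd b.
  move=> /mapP[p ps ->] /mapP[q qs ->].
  by have /andP[-> _] := allP xs p ps; have /andP[_ ->] := allP xs q qs.
apply/allP/allP => H.
  move=> v; rewrite mem_iota => vm; rewrite -implyNb; apply/implyP => tv.
  apply/negP => bv.
  have /mapP[p ps p1] : v.+1 \in [seq p.1 | p <- descent_pairs s] by rewrite mem_tops tv andbT; lia.
  have /mapP[q qs q2] : v \in [seq p.2 | p <- descent_pairs s] by rewrite mem_bottoms bv andbT; lia.
  by have := allP (H p ps) q qs; rewrite -p1 -q2 ltnSn subSnn.
move=> p ps; apply/allP => q qs; apply/implyP => lt_qp.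
have tp := map_f (fun p => p.1) ps; have bq := map_f (fun p => p.2) qs.
have := gap _ _ tp bq; move: tp bq.
rewrite mem_tops mem_bottoms => /andP[pm tp] /andP[qm bq].
move: (p.1) (q.2) lt_qp tp bq pm qm => t b.
move=> lt_bt tp bq /andP[_ tm] /andP[b0 _] /andP[t_even b_odd].
have [E|ne] := eqVneq t b.+1; last by move: lt_bt ne t_even b_odd; clear; lia.
move: tp (H b); rewrite E => /negPf ->; rewrite bq mem_iota b0 add1n prednK; last first.
  exact: leq_ltn_trans (leq0n _) (leq_trans lt_bt tm).
by rewrite (leq_trans lt_bt tm) => /(_ isT).
Qed.

(** * Histories and Motzkin paths *)

(** The fourth type, a double descent, cannot occur: its letter would be a top and a bottom, hence
    both even and odd. *)
Definition valley := (true, true).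
Definition ascent := (false, true).
Definition peak := (false, false).

(* In each pair the type of the even letter [2i] precedes that of [2i-1]. *)
Definition optX : seq ((bool * bool) * (bool * bool)) :=
  [:: (ascent, ascent); (ascent, valley); (peak, ascent); (peak, valley)].
Definition optG : seq ((bool * bool) * (bool * bool)) :=
  [:: (ascent, ascent); (ascent, valley); (peak, ascent)].

Fixpoint histories opts (n : nat) : seq (seq (bool * bool)) :=
  if n is n'.+1 then
    [seq o.1 :: o.2 :: tau | o <- opts, tau <- histories opts n']
  else [:: [::]].

Lemma histories_uniq opts n : uniq opts -> uniq (histories opts n).
Proof.
move=> u_opts; elim: n => //= n IH; apply: allpairs_uniq => //.
by move=> [[a b] t] [[a' b'] t'] _ _ /= [-> -> ->].
Qed.

Lemma size_histories opts n tau : tau \in histories opts n -> size tau = n.*2.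
Proof.
elim: n tau => [|n IH] tau /=; first by rewrite inE => /eqP ->.
by case/allpairsP => -[o t] [_ ht ->]; rewrite /= (IH _ ht).
Qed.

Lemma mem_histories opts n u :
  (types n.*2 u \in histories opts n) =
  all (fun i => (typ u i.*2.+2, typ u i.*2.+1) \in opts) (iota 0 n).
Proof.
elim: n => // n IH; have -> : iota 0 n.+1 = rcons (iota 0 n) n.
  by rewrite -cats1 -[in LHS](addn1 n) iotaD.
rewrite all_rcons -IH /=; apply/allpairsP/andP => [[[[a b] t] /= [ho ht [-> -> ->]]] //|[ho ht]].
by exists ((typ u n.*2.+2, typ u n.*2.+1), types n.*2 u).
Qed.

Lemma inX_histories n (s : 'S_(n.*2)) :
  inX s = (types n.*2 (closed_word s) \in histories optX n).
Proof.
rewrite mem_histories inX_typ; set T := typ _.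
have optXE x y : ((x, y) \in optX) = ~~ x.1 && y.2.
  by case: x y => [[] []] [[] []].
apply/allP/allP => H v; rewrite mem_iota => vn.
  have h1 : v.*2.+1 \in iota 1 n.*2 by rewrite mem_iota; lia.
  have h2 : v.*2.+2 \in iota 1 n.*2 by rewrite mem_iota; lia.
  move: (H _ h1) (H _ h2); rewrite optXE [odd _]/= [odd v.*2.+2]/= negbK odd_double !orbF.
  by rewrite implybF => /andP[-> _] /andP[_ ->].
have [ov|ev] := boolP (odd v).
  have hv : v./2 \in iota 0 n by rewrite mem_iota; lia.
  move: (H _ hv); rewrite optXE; have -> : v./2.*2.+1 = v by lia.
  by case/andP => _ ->; rewrite implybT.
have hv : v./2.-1 \in iota 0 n by rewrite mem_iota; lia.
move: (H _ hv); rewrite optXE; have -> : v./2.-1.*2.+2 = v by lia.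
by case/andP => /negPf -> _; rewrite orbT.
Qed.

Lemma primary_histories n (s : 'S_(n.*2)) :
  primary s = (types n.*2 (closed_word s) \in histories optG n).
Proof.
rewrite primary_typ inX_histories !mem_histories; set T := typ _.
have optGE x y : ((x, y) \in optG) = ((x, y) \in optX) && (x.2 || ~~ y.1).
  by case: x y => [[] []] [[] []].
have optXE x y : ((x, y) \in optX) = ~~ x.1 && y.2.
  by case: x y => [[] []] [[] []].
rewrite (eq_all (fun i => optGE _ _)) (all_predI _ _ (iota 0 n)); apply: andb_id2l.
move=> /allP hX; apply/allP/allP => H v; rewrite mem_iota => vn.
  by apply: H; rewrite mem_iota; lia.
have [ov|ev] := boolP (odd v).
  have hv : v./2 \in iota 0 n by rewrite mem_iota; lia.
  by have := H _ hv; have -> : v./2.*2.+1 = v by lia.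
(* For even [v] the condition follows from [hX], since an even letter is never a descent bottom. *)
have hv : v./2.-1 \in iota 0 n by rewrite mem_iota; lia.
have := hX _ hv; rewrite optXE; have -> : v./2.-1.*2.+2 = v by lia.
by case/andP => /negPf -> _; rewrite orbT.
Qed.

Local Open Scope ring_scope.

(** * Weighted sums over histories and their recurrence *)

Definition tau_weight (tau : seq (bool * bool)) : {poly int} :=
  (size (states tau))%:R * 'X^(count (fun a => ~~ a.2) tau).

Definition level_sum opts n b : {poly int} :=
  \sum_(tau <- histories opts n | bars tau == b) tau_weight tau.

(** Permutations are grouped by their type sequence; a closed word has just one bar, so only
    histories ending with one bar contribute. *)
Lemma sum_des opts n (Q : pred 'S_(n.*2)) : uniq opts ->
  (forall s, Q s = (types n.*2 (closed_word s) \in histories opts n)) ->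
  \sum_(s | Q s) 'X^(des s) = level_sum opts n 1 :> {poly int}.
Proof.
move=> u_opts QE; have uH := histories_uniq n u_opts.
under eq_bigl => s do rewrite QE.
(* The list of histories has no duplicates, so the inner sum has at most one term and acts as an
   indicator. *)
transitivity (\sum_(s : 'S_(n.*2))
  \sum_(tau <- histories opts n | types n.*2 (closed_word s) == tau)
   ('X^(des s) : {poly int})).
  rewrite big_mkcond /=; apply: eq_bigr => s _; case: ifP => hs.
    rewrite (big_rem _ hs) /= eqxx big_seq_cond big1 ?addr0 // => tau.
    by rewrite mem_rem_uniq // !inE => /andP[/andP[/eqP ne _] /eqP e]; case: ne.
  by rewrite big_seq_cond big1 // => tau /andP[ht /eqP e]; rewrite e ht in hs.
rewrite (exchange_big_dep xpredT) //= /level_sum [RHS]big_mkcond /=.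
rewrite big_seq [RHS]big_seq; apply: eq_bigr => tau ht.
rewrite (eq_bigr (fun=> 'X^(count (fun a => ~~ a.2) tau))); last first.
  by move=> s /eqP <-; rewrite des_types.
rewrite sumr_const -mulr_natl.
have := card_types (size_histories ht); rewrite cardsE => ->.
by case: ifP => _; rewrite ?mul0r.
Qed.

(* Weighted Motzkin paths of length [n] from 1 to [b], with level weight [m b^2]. *)
Fixpoint paths (m : {poly int}) (n b : nat) : {poly int} :=
  if n is n'.+1 then
    (b.-1 * b)%:R * paths m n' b.-1 + (b ^ 2)%:R * (m * paths m n' b)
      + (b * b.+1)%:R * ('X * paths m n' b.+1)
  else (b == 1)%:R.

Lemma level_sumS opts n b : level_sum opts n.+1 b =
  \sum_(o <- opts) \sum_(tau <- histories opts n | bars (o.1 :: o.2 :: tau) == b)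
     tau_weight (o.1 :: o.2 :: tau).
Proof.
rewrite /level_sum big_mkcond big_allpairs_dep /=; apply: eq_bigr => o _.
by rewrite -big_mkcond.
Qed.

Lemma tau_weight_cons a b tau : tau_weight (a :: b :: tau) =
  ((bars tau - ~~ b.2) * ((bars tau).-1 + b.1 + b.2 - ~~ a.2))%N%:R *
  'X^(~~ a.2 + ~~ b.2)%N * tau_weight tau.
Proof. rewrite /tau_weight !size_states [bars (b :: tau)]/= !natrM [count _ _]/= !exprD; ring. Qed.

(** Here [c] and [k] are the numbers of bars before and after the two insertions, and [N] is the
    number of ways. The shift from [c] to [k] is required only where the number of ways is nonzero,
    which avoids the cases of truncated subtraction. *)
Lemma sum_step opts n (a b : bool * bool) (c k N : nat) :
  (forall m, (m - ~~ b.2) * (m.-1 + b.1 + b.2 - ~~ a.2) != 0 ->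
     ((m.-1 + b.1 + b.2).-1 + a.1 + a.2 == k) = (m == c))%N ->
  ((c - ~~ b.2) * (c.-1 + b.1 + b.2 - ~~ a.2) = N)%N ->
  \sum_(tau <- histories opts n | bars (a :: b :: tau) == k) tau_weight (a :: b :: tau)
  = N%:R * ('X^(~~ a.2 + ~~ b.2)%N * level_sum opts n c).
Proof.
move=> hF <-; rewrite /level_sum mulrA big_distrr /= big_mkcond [RHS]big_mkcond /=.
apply: eq_bigr => tau _; rewrite tau_weight_cons; set F := (_ * _)%N.
have [F0|F0] := eqVneq F 0%N.
  rewrite F0 !mul0r if_same; case: eqP => // <-.
  by rewrite -/F F0 !mul0r.
by rewrite (hF _ F0); case: eqP => [<-|].
Qed.

Lemma level_sum0 opts b : level_sum opts 0 b = (b == 1%N)%:R.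
Proof.
rewrite /level_sum big_mkcond big_seq1 /= eq_sym; case: eqP => // _.
by rewrite /tau_weight expr0 mulr1.
Qed.

Lemma sum_ascent_ascent opts n k :
  \sum_(tau <- histories opts n | bars (ascent :: ascent :: tau) == k)
    tau_weight (ascent :: ascent :: tau) = (k ^ 2)%:R * level_sum opts n k.
Proof. rewrite (@sum_step _ _ _ _ k _ (k ^ 2)%N) ?mul1r //= ?expnS; nia. Qed.

Lemma sum_ascent_valley opts n k :
  \sum_(tau <- histories opts n | bars (ascent :: valley :: tau) == k)
    tau_weight (ascent :: valley :: tau) = (k.-1 * k)%:R * level_sum opts n k.-1.
Proof. rewrite (@sum_step _ _ _ _ k.-1 _ (k.-1 * k)%N) ?mul1r //=; nia. Qed.

Lemma sum_peak_ascent opts n k :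
  \sum_(tau <- histories opts n | bars (peak :: ascent :: tau) == k)
    tau_weight (peak :: ascent :: tau) = (k * k.+1)%:R * ('X * level_sum opts n k.+1).
Proof. rewrite (@sum_step _ _ _ _ k.+1 _ (k * k.+1)%N) //=; nia. Qed.

Lemma sum_peak_valley opts n k :
  \sum_(tau <- histories opts n | bars (peak :: valley :: tau) == k)
    tau_weight (peak :: valley :: tau) = (k ^ 2)%:R * ('X * level_sum opts n k).
Proof. rewrite (@sum_step _ _ _ _ k _ (k ^ 2)%N) //= ?expnS; nia. Qed.

Lemma level_sum_X n b : level_sum optX n b = paths (1 + 'X) n b.
Proof.
elim: n b => [|n IH] b; first exact: level_sum0.
rewrite level_sumS /optX !big_cons big_nil sum_ascent_ascent sum_ascent_valley.
rewrite sum_peak_ascent sum_peak_valley !IH /=; ring.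
Qed.

Lemma level_sum_G n b : level_sum optG n b = paths 1 n b.
Proof.
elim: n b => [|n IH] b; first exact: level_sum0.
rewrite level_sumS /optG !big_cons big_nil sum_ascent_ascent sum_ascent_valley.
rewrite sum_peak_ascent !IH /=; ring.
Qed.

Lemma Xpoly_paths n : Xpoly n = paths (1 + 'X) n 1.
Proof. by rewrite -level_sum_X -(@sum_des _ _ _ _ (@inX_histories n)). Qed.

Lemma primary_paths n : \sum_(s : 'S_(n.*2) | primary s) 'X^(des s) = paths 1 n 1.
Proof. by rewrite -level_sum_G -(@sum_des _ _ _ _ (@primary_histories n)). Qed.

(** * The gamma expansion *)

Lemma gamma_paths n j : (gamma n j)%:R = (paths 1 n 1)`_j.
Proof.
rewrite -primary_paths coef_sum /gamma -sum1_card natr_sum big_mkcond [RHS]big_mkcond /=.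
apply: eq_bigr => s _; rewrite inE coefXn eq_sym.
by case: (primary s) => //=; case: eqP.
Qed.

Lemma paths_coefS n b j : (paths 1 n.+1 b)`_j =
  (paths 1 n b.-1)`_j *+ (b.-1 * b) + (paths 1 n b)`_j *+ (b ^ 2)
  + (if j is j'.+1 then (paths 1 n b.+1)`_j' else 0) *+ (b * b.+1).
Proof.
rewrite /= mul1r !mulr_natl !coefD !coefMn coefXM.
by case: j.
Qed.

(** The power of ['X] counts down steps. A path from 1 to [b] with [j] of them has [b - 1 + j] up
    steps, hence length at least [b - 1 + j.*2]. *)
Lemma paths_coef_eq0 n b j : (0 < b)%N -> (n.+1 < b + j.*2)%N -> (paths 1 n b)`_j = 0.
Proof.
elim: n b j => [|n IH] b j b0 hn.
  rewrite /= -polyC_natr coefC; case: j hn => [|j] //=.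
  by case: eqP => // ->.
rewrite paths_coefS (IH b j) //; last by lia.
have -> : (if j is j'.+1 then (paths 1 n b.+1)`_j' else 0) = 0.
  by case: j hn => // j hn; apply: IH => //; lia.
rewrite !mul0rn !addr0; case: b b0 hn => // -[|b] _ hn; first by rewrite mulr0n.
by rewrite IH ?mul0rn //=; lia.
Qed.

(** A path with [j] down steps has [n.+1 - b - j.*2] level steps, and each of them changes its
    weight by the factor [1 + 'X]. *)
Lemma paths_gamma_expansion n b N : (0 < b)%N -> (n < N)%N ->
  paths (1 + 'X) n b =
  \sum_(j < N) ((paths 1 n b)`_j)%:P * ('X^j * (1 + 'X) ^+ (n.+1 - b - j.*2)).
Proof.
elim: n b N => [|n IH] b [|N] b0 // nN.
  rewrite big_ord_recl big1 ?addr0 => [|i _]; last by rewrite lift0 paths_coef_eq0 ?mul0r //; lia.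
  rewrite -[paths 1 0 b]/(b == 1%N)%:R -polyC_natr coefC /= mul1r -polyC_natr.
  by case: eqP => [->|_]; rewrite ?mul0r // expr0 mulr1.
under eq_bigr => j _ do rewrite paths_coefS !polyCD !polyCMn !mulrDl !mulrnAl.
rewrite !big_split /= !mulr_natl !sumrMnl; congr (_ + _ *+ _ + _ *+ _).
- case: b b0 => // -[|b] _; first by rewrite !mulr0n.
  rewrite (IH b.+1 N.+1) ?(ltnW nN) //; congr (_ *+ _); apply: eq_bigr => j _.
- rewrite (IH b N.+1) ?(ltnW nN) // mulr_sumr; apply: eq_bigr => j _.
  (* Where the exponent would be truncated, the coefficient vanishes. *)
  have [hj|hj] := ltnP n.+1 (b + j.*2); first by rewrite paths_coef_eq0 // !mul0r mulr0.
  rewrite (_ : n.+2 - b - j.*2 = (n.+1 - b - j.*2).+1)%N; last by lia.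
  by rewrite exprS; ring.
(* The factor ['X] of a down step shifts [j] by one, so the induction hypothesis is needed with the
   smaller bound [N]. *)
rewrite big_ord_recl mul0r add0r (IH b.+1 N) // mulr_sumr; apply: eq_bigr => j _.
rewrite lift0 exprS (_ : n.+2 - b - j.+1.*2 = n.+1 - b.+1 - j.*2)%N; last by lia.
by ring.
Qed.

Lemma Xpoly_expansion n : Xpoly n =
  \sum_(j < n./2.+1) (gamma n j)%:R *: ('X^j * (1 + 'X) ^+ (n - j.*2)).
Proof.
rewrite Xpoly_paths (@paths_gamma_expansion _ _ n.+1) //.
rewrite (@big_ord_widen _ _ _ _ n.+1
  (fun j => (gamma n j)%:R *: ('X^j * (1 + 'X) ^+ (n - j.*2)))); last by lia.
rewrite [RHS]big_mkcond; apply: eq_bigr => j _ /=; rewrite subn1 gamma_paths mul_polyC.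
by case: ltnP => // hj; rewrite paths_coef_eq0 ?scale0r //; lia.
Qed.

Lemma Gpoly_paths n : Gpoly n = paths 1 n 1.
Proof.
rewrite /Gpoly; case: eqP => [->|_] //.
rewrite -(poly_def _ (fun j => (gamma n j)%:R)); apply/polyP => j; rewrite coef_poly.
case: ltnP => hj; first exact: gamma_paths.
by rewrite paths_coef_eq0 //; lia.
Qed.

(** * The continued fraction *)

(* The coefficients of [x f(x) g(x)]. *)
Definition xconv (f g : series) : series :=
  fun n => \sum_(i < n) f i * g (n - i.+1)%N.

Lemma eq_xconv f f' g g' n : (forall i, (i < n)%N -> f i = f' i) ->
  (forall i, (i < n)%N -> g i = g' i) -> xconv f g n = xconv f' g' n.
Proof. by move=> ff gg; apply: eq_bigr => i _; rewrite ff // gg //; have := ltn_ord i; lia. Qed.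

Lemma xconv_coef (p q : {poly {poly int}}) n :
  xconv (fun i => p`_i) (fun i => q`_i) n = ('X * (p * q))`_n.
Proof.
rewrite coefXM; case: n => [|n]; first by rewrite /xconv big_ord0.
by rewrite coefM; apply: eq_bigr => i _; rewrite subSS.
Qed.

(** Only coefficients below [n] matter, so the series are cut off to polynomials, where
    associativity is that of the product. *)
Lemma xconvA f g h n : xconv (xconv f g) h n = xconv f (xconv g h) n.
Proof.
pose P (f : series) := \poly_(i < n) f i.
have PE (f0 : series) i : (i < n)%N -> f0 i = (P f0)`_i by rewrite coef_poly => ->.
have PPE (f0 g0 : series) i : (i < n)%N -> xconv f0 g0 i = ('X * (P f0 * P g0))`_i.
  by move=> im; rewrite -xconv_coef; apply: eq_xconv => j ji; apply: PE; apply: ltn_trans im.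
rewrite (eq_xconv (PPE f g) (PE h)) (eq_xconv (PE f) (PPE g h)) !xconv_coef.
by congr (nth 0 (polyseq _) n); ring.
Qed.

Lemma size_inv_seq f n : size (inv_seq f n) = n.+1.
Proof. by elim: n => //= n IH; rewrite size_rcons IH. Qed.

Lemma nth_inv_seq f n i : (i <= n)%N -> (inv_seq f n)`_i = sinv f i.
Proof.
elim: n => [|n IH]; first by rewrite leqn0 => /eqP ->.
rewrite leq_eqVlt => /predU1P[->//|ltin].
by rewrite /= nth_rcons size_inv_seq ltin IH.
Qed.

Lemma sinvS f n : sinv f n.+1 = - \sum_(k < n.+1) f k.+1 * sinv f (n - k)%N.
Proof.
rewrite {1}/sinv /= nth_rcons size_inv_seq ltnn eqxx; congr (- _).
by apply: eq_bigr => k _; rewrite subSS nth_inv_seq // leq_subr.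
Qed.

(** The inverse F of the denominator satisfies F = 1 + mu x F + lambda x^2 T F; one factor x is
    contained in [xconv]. *)
Lemma sinv_denomS h T n : sinv (denom h T) n.+1 =
  mu h * sinv (denom h T) n + lambda h.+1 * xconv T (sinv (denom h T)) n.
Proof.
rewrite sinvS big_ord_recl /= subn0 opprD mulNr opprK; congr (_ + _).
rewrite -sumrN /xconv mulr_sumr; apply: eq_bigr => i _.
by rewrite mulNr opprK mulrA.
Qed.

(* The continued fraction truncated at depth [k] from the level [h] on. *)
Definition tail (k h : nat) : series := if (h <= k)%N then cf (k - h) h else fun=> 0.

Lemma tail0 k h : (h <= k)%N -> tail k h 0 = 1.
Proof. by rewrite /tail => ->; case: (k - h)%N. Qed.

Lemma tailS k h n : (h <= k)%N ->
  tail k h n.+1 = mu h * tail k h n + lambda h.+1 * xconv (tail k h.+1) (tail k h) n.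
Proof.
rewrite /tail => hk; rewrite hk; case: ltnP => hk1.
  rewrite (_ : k - h = (k - h.+1).+1)%N; last by lia.
  exact: sinv_denomS.
have -> : (k - h = 0)%N by lia.
exact: sinv_denomS.
Qed.

(* By first passage to each level, the generating function of the paths of height
   at most [k] ending at level [h] is a product of tails of the continued fraction. *)
Fixpoint tail_prod (k h : nat) : series :=
  if h is h'.+1 then
    fun n => (h'.+1 * h'.+2)%:R * xconv (tail k h) (tail_prod k h') n
  else tail k 0.

(** Factors [lambda] into the weights of the up step and of the down step between two consecutive
    levels. *)
Lemma lambdaE h : lambda h.+1 = (h.+1 * h.+2)%:R * (h.+1 * h.+2)%:R * 'X.
Proof. by rewrite /lambda scaler_nat -natrM mulr_natl; congr (_ *+ _); rewrite !expnS; lia. Qed.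

Lemma xconv0 f g : xconv f g 0 = 0.
Proof. exact: big_ord0. Qed.

Lemma xconvS f g n : xconv f g n.+1 = f 0%N * g n + xconv (fun i => f i.+1) g n.
Proof. by rewrite /xconv big_ord_recl subn1. Qed.

Lemma xconvDl a b f g e n :
  xconv (fun i => a * f i + b * g i) e n = a * xconv f e n + b * xconv g e n.
Proof. by rewrite /xconv !mulr_sumr -big_split /=; apply: eq_bigr => i _; ring. Qed.

Lemma xconvZr a f g n : xconv f (fun i => a * g i) n = a * xconv f g n.
Proof. by rewrite /xconv mulr_sumr; apply: eq_bigr => i _; ring. Qed.

Lemma tail_prod0 k h : tail_prod k h 0 = (h == 0%N)%:R.
Proof. by case: h => [|h] /=; rewrite ?tail0 // xconv0 mulr0. Qed.

(** Expand the outermost tail: its constant term yields the up step, [mu] the level step, and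
    [lambda] with [xconvA] the down step. This is the recurrence of [paths 1] with [b = h.+1]. *)
Lemma tail_prodS k h n : (h <= k)%N ->
  tail_prod k h n.+1 =
    (h * h.+1)%:R * tail_prod k h.-1 n + (h.+1 ^ 2)%:R * tail_prod k h n
    + (h.+1 * h.+2)%:R * ('X * tail_prod k h.+1 n).
Proof.
case: h => [|h] hk.
  by rewrite /= tailS // lambdaE /mu; ring.
rewrite [LHS]/= xconvS tail0 // mul1r.
rewrite (@eq_xconv _ (fun i => mu h.+1 * tail k h.+1 i
   + lambda h.+2 * xconv (tail k h.+2) (tail k h.+1) i) _ (tail_prod k h)) //; last first.
  by move=> i _; exact: tailS.
rewrite xconvDl xconvA lambdaE /mu /=.
by rewrite [in RHS]xconvZr; ring.
Qed.

(** Paths of length at most [k] never climb above the truncation height. *)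
Lemma tail_prod_paths k n h : (n <= k)%N -> (h <= k.+1)%N ->
  tail_prod k h n = paths 1 n h.+1.
Proof.
elim: n h => [|n IH] h nk hk; first by rewrite tail_prod0.
move: hk; rewrite leq_eqVlt => /predU1P[->|hk].
  (* At level [k.+1] the tail is zero by convention, and the path sum is zero because the path is
     too short. *)
  rewrite [LHS]/= /xconv big1 ?mulr0 => [|i _]; last by rewrite /tail ltnn mul0r.
  by apply/esym/polyP => j; rewrite coef0 paths_coef_eq0 //; lia.
rewrite tail_prodS // !IH ?(ltnW nk) //; last first.
  by rewrite (leq_trans (leq_pred _)) // ltnW.
  exact: ltnW.
rewrite [RHS]/= mul1r; case: h hk => [|h] hk //=.
by rewrite !mul0r.
Qed.

Theorem mainTheorem1 :
  (forall n : nat, (1 <= n)%N ->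
     Xpoly n = \sum_(j < n./2.+1)
                 (gamma n j)%:R *: ('X^j * (1 + 'X) ^+ (n - j.*2)))
  /\
  (forall n : nat, exists K : nat, forall k : nat, (K <= k)%N ->
     cf k 0 n = Gpoly n).
Proof.
split=> n; first by move=> _; exact: Xpoly_expansion.
(* Depth [n] suffices for the coefficient of x^n, by the bound [n <= k] in [tail_prod_paths]. *)
exists n => k nk; rewrite Gpoly_paths -(@tail_prod_paths k) //.
by rewrite /= /tail subn0.
Qed.
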